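(* Let $n\ge 8$ be an even integer and let $I=\{2,3,\ldots,\frac{n}{2}-2\}$. The core of the $2$-section $[3\text{-}UQI(n,2)]_2$ is isomorphic to the core of the merged Johnson graph $J(n,\frac{n}{2})_I$, and the core of $J(n,\frac{n}{2})_I$ is a proper subgraph of $J(n,\frac{n}{2})_I$. Thus, if the core of $J(n,\frac{n}{2})_I$ has order $\frac12\binom{n}{n/2}$, then $3\text{-}UQI(n,2)$ is a core.
   Context: $[n]=\{1,\dots,n\}$. A hypergraph $H=(V,E)$ consists of a finite set $V$ of vertices and a set $E$ of non-empty subsets of $V$ (hyperedges) whose union is $V$. A homomorphism $f:H\to H_1$ from $H=(V,E)$ to $H_1=(V_1,E_1)$ is a map $f:V\to V_1$ such that for every $e\in E$ there is $e'\in E_1$ with $f(e)\subseteq e'$ and $|f(e)|=|e|$ (for graphs: the usual graph homomorphisms). An endomorphism is a homomorphism $H\to H$; an automorphism is a bijective endomorphism. $H$ is a core if every endomorphism of $H$ is an automorphism. The core of $H$ (or of a graph) is a subhypergraph $H^\bullet$ (subgraph) that is a core and for which a homomorphism $H\to H^\bullet$ exists; it is unique up to isomorphism. The order is the number of vertices. Definition of $3\text{-}QI(n,2)$ (for $n\ge 8$): its vertices are all binary strings of length $n$ with entries in $\{0,1\}$ whose first entry is $0$ and in which each symbol occurs at least $4$ times; equivalently, the unordered partitions $\{A,\overline{A}\}$ of $[n]$ with $|A|,|\overline{A}|\ge 4$. Three vertices $v_1,v_2,v_3$ form a hyperedge if and only if for every $(g_1,g_2,g_3)\in\{0,1\}^3$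 there is an index $j$ with $v_i[j]=g_i$ for $i=1,2,3$ (equivalently, all eight triple intersections of parts, one part from each partition, are non-empty). For $n$ even, $3\text{-}UQI(n,2)$ is the subhypergraph of $3\text{-}QI(n,2)$ induced on the vertices in which each symbol occurs exactly $n/2$ times (its hyperedges are all hyperedges of $3\text{-}QI(n,2)$ contained in this vertex set). The $2$-section $[H]_2$ of a $3$-uniform hypergraph $H$ is the graph on the same vertex set in which two distinct vertices are adjacent iff they lie together in some hyperedge of $H$. The merged Johnson graph $J(n,m)_I$ has as vertices all $m$-subsets of $[n]$, with $M,M'$ adjacent iff $|M\cap M'|\in I$. *)

(* Defs.v *)
From mathcomp Require Import all_boot.

Set Implicit Arguments.
Unset Strict Implicit.
Unset Printing Implicit Defensive.

Record sgraph := SGraph {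
  vertex :> finType;
  adj : rel vertex;
  adj_sym : symmetric adj;
  adj_irrefl : irreflexive adj }.

Definition ghom (G K : sgraph) (f : G -> K) : Prop :=
  forall x y, adj x y -> adj (f x) (f y).

Definition gautomorphism (G : sgraph) (f : G -> G) : Prop :=
  ghom f /\ bijective f.

Definition is_gcore (G : sgraph) : Prop :=
  forall f : G -> G, ghom f -> gautomorphism f.

Definition giso (G K : sgraph) : Prop :=
  exists f : G -> K, bijective f /\ forall x y, adj (f x) (f y) = adj x y.

(* Subgraphs are arbitrary, not necessarily induced or spanning. *)
Record subgraph (G : sgraph) := Subgraph {
  sub_vertices : {set G};
  sub_adj : rel G;
  sub_adj_sym : symmetric sub_adj;
  sub_adjW : forall x y, sub_adj x y ->
    [/\ x \in sub_vertices, y \in sub_vertices & adj x y] }.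

Section SubgraphGraph.
Variables (G : sgraph) (C : subgraph G).

Definition subgraph_adj : rel {x : G | x \in sub_vertices C} :=
  fun x y => sub_adj C (val x) (val y).

Lemma subgraph_adj_sym : symmetric subgraph_adj.
Proof. by move=> x y; apply: sub_adj_sym. Qed.

Lemma subgraph_adj_irrefl : irreflexive subgraph_adj.
Proof.
by move=> x; apply/negP => /sub_adjW [_ _]; rewrite adj_irrefl.
Qed.

Definition sgraph_of_subgraph : sgraph :=
  SGraph subgraph_adj_sym subgraph_adj_irrefl.
End SubgraphGraph.

Coercion sgraph_of_subgraph : subgraph >-> sgraph.

Definition proper_subgraph (G : sgraph) (C : subgraph G) : Prop :=
  ~ (sub_vertices C = [set: G] /\ forall x y : G, sub_adj C x y = adj x y).

Definition is_core_of (G : sgraph) (C : subgraph G) : Prop :=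
  is_gcore C /\ exists f : G -> C, ghom f.

Section CoreExists.
Variable G : sgraph.

Definition induced_adj (S : {set G}) : rel G :=
  fun x y => [&& x \in S, y \in S & adj x y].

Lemma induced_adj_sym S : symmetric (induced_adj S).
Proof. by move=> x y; rewrite /induced_adj adj_sym andbCA. Qed.

Lemma induced_adjW S x y : induced_adj S x y ->
  [/\ x \in S, y \in S & adj x y].
Proof. by case/and3P. Qed.

Definition induced_subgraph (S : {set G}) : subgraph G :=
  Subgraph (@induced_adj_sym S) (@induced_adjW S).

(* Every graph has a core, so statements about all cores are not vacuous. *)
Lemma core_exists : exists C : subgraph G, is_core_of C.
Proof.
pose hom (f : {ffun G -> G}) := [forall x, forall y, adj x y ==> adj (f x) (f y)].
have homP f : hom f -> forall x y, adj x y -> adj (f x) (f y).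
  by move=> /forallP h x y; move/forallP: (h x) => /(_ y) /implyP.
have hid : hom [ffun x => x].
  by apply/forallP => x; apply/forallP => y; rewrite !ffunE; apply/implyP.
case: (arg_minnP (fun f : {ffun G -> G} => #|f @: setT|) hid) => f hf minf.
have fS x : f x \in f @: setT by rewrite imset_f.
exists (induced_subgraph (f @: setT)); split; last first.
  exists (fun x => exist _ (f x) (fS x)) => x y xy.
  by rewrite /= /subgraph_adj /= /induced_adj !fS homP.
move=> g hg; split=> //; apply: injF_bij; apply/injectiveP; apply: contraT => ninj.
pose k := [ffun x => val (g (exist _ (f x) (fS x)))].
have hk : hom k.
  apply/forallP => x; apply/forallP => y; apply/implyP => xy; rewrite !ffunE.
  suff /induced_adjW[] : induced_adj (f @: setT)
    (val (g (exist _ (f x) (fS x)))) (val (g (exist _ (f y) (fS y)))) by [].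
  by apply: hg; rewrite /= /subgraph_adj /= /induced_adj !fS homP.
have := minf k hk; rewrite leqNgt => /negP[].
have sub : k @: setT \subset val @: (g @: setT).
  by apply/subsetP => _ /imsetP[x _ ->]; rewrite ffunE !imset_f.
apply: (leq_ltn_trans (subset_leq_card sub)).
rewrite (card_imset _ val_inj).
have cS : #|f @: setT| = #|[set: induced_subgraph (f @: setT)]|.
  by rewrite cardsT card_sig; apply: eq_card.
rewrite cS ltn_neqAle leq_imset_card andbT.
apply: contra ninj => /imset_injP ig; apply/injectiveP => x y.
by apply: ig; rewrite in_setT.
Qed.
End CoreExists.

Record hypergraph := Hypergraph {
  hvertex :> finType;
  hedges : {set {set hvertex}};
  hedges_neq0 : set0 \notin hedges;
  hedges_cover : cover hedges = [set: hvertex] }.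

Definition hhom (H K : hypergraph) (f : H -> K) : Prop :=
  forall e, e \in hedges H ->
    exists e', [/\ e' \in hedges K, f @: e \subset e' & #|f @: e| = #|e|].

Definition hautomorphism (H : hypergraph) (f : H -> H) : Prop :=
  hhom f /\ bijective f.

Definition is_hcore (H : hypergraph) : Prop :=
  forall f : H -> H, hhom f -> hautomorphism f.

Section InducedHypergraph.
Variables (H : hypergraph) (S : {set H}).

Definition induced_hedges : {set {set {x : H | x \in S}}} :=
  [set e : {set {x : H | x \in S}} | val @: e \in hedges H].

Lemma induced_hedges_neq0 : set0 \notin induced_hedges.
Proof. by rewrite inE imset0 hedges_neq0. Qed.

Hypothesis induced_cover : cover induced_hedges = setT.

Definition induced_hypergraph : hypergraph :=
  Hypergraph induced_hedges_neq0 induced_cover.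
End InducedHypergraph.

Section TwoSection.
Variable H : hypergraph.

Definition two_section_adj : rel H :=
  fun x y => (x != y) && [exists e in hedges H, (x \in e) && (y \in e)].

Lemma two_section_sym : symmetric two_section_adj.
Proof.
move=> x y; rewrite /two_section_adj eq_sym; congr (_ && _).
by apply: eq_existsb => e; rewrite [(x \in e) && _]andbC.
Qed.

Lemma two_section_irrefl : irreflexive two_section_adj.
Proof. by move=> x; rewrite /two_section_adj eqxx. Qed.

Definition two_section : sgraph := SGraph two_section_sym two_section_irrefl.
End TwoSection.

(* Strings are functions from 'I_n to bool, with false for 0 and true for 1; *)
(* positions are numbered from 0.                                            *)
Section QI.
Variable n : nat.

Definition occurrences (b : bool) (v : {ffun 'I_n -> bool}) : nat :=
  #|[set i | v i == b]|.

Definition qi_vertex (v : {ffun 'I_n -> bool}) : bool :=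
  [forall i : 'I_n, (val i == 0) ==> (v i == false)] &&
  [forall b : bool, 4 <= occurrences b v].

Definition qi_independent (v1 v2 v3 : {ffun 'I_n -> bool}) : bool :=
  [forall g1 : bool, forall g2 : bool, forall g3 : bool,
     exists j, [&& v1 j == g1, v2 j == g2 & v3 j == g3]].

Definition QI3_vertex : finType := {v : {ffun 'I_n -> bool} | qi_vertex v}.

Definition QI3_hedges : {set {set QI3_vertex}} :=
  [set e : {set QI3_vertex} | [exists v1, exists v2, exists v3,
     (e == [set v1; v2; v3]) && qi_independent (val v1) (val v2) (val v3)]].
End QI.

(* Each vertex [v] lies in a hyperedge: split both fibres of [v] along the  *)
(* two low bits of the rank of a position within its fibre.                 *)
Section Covering.
Variables (n : nat) (v : {ffun 'I_n -> bool}).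

Let cls (b : bool) : seq 'I_n := enum [set i | v i == b].
Let rank (i : 'I_n) : nat := index i (cls (v i)).

Let size_cls b : size (cls b) = occurrences b v.
Proof. by rewrite /cls -cardE. Qed.

Let count_rank b (p : pred nat) :
  #|[set i | (v i == b) && p (rank i)]| = count p (iota 0 (occurrences b v)).
Proof.
rewrite -size_cls; have us : uniq (cls b) by apply: enum_uniq.
have -> : iota 0 (size (cls b)) = [seq index i (cls b) | i <- cls b].
  apply: (@eq_from_nth _ 0) => [|k]; rewrite size_iota ?size_map // => kn.
  have i0 : 'I_n by case: (cls b) kn => // a.
  by rewrite (nth_map i0) // nth_iota // index_uniq.
rewrite count_map -size_filter cardE; apply: perm_size.
apply: uniq_perm; first exact: enum_uniq.
  by rewrite filter_uniq.
move=> i.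
 rewrite mem_enum mem_filter /cls mem_enum !inE /= /rank.
by case: eqP => [->|]; rewrite ?andbT ?andbF.
Qed.

Let companion (p : pred nat) : {ffun 'I_n -> bool} :=
  [ffun i => v i (+) p (rank i)].

Let occ_companion b p : occurrences b (companion p) =
  count (fun k => p k == b) (iota 0 (occurrences false v)) +
  count (fun k => p k == ~~ b) (iota 0 (occurrences true v)).
Proof.
rewrite -!count_rank -cardsUI [X in _ + X](_ : _ = 0) ?addn0.
  apply: eq_card => i; rewrite !inE ffunE.
  by case: (v i); case: (p _); case: b.
by apply: eq_card0 => i; rewrite !inE; case: (v i); rewrite ?andbF.
Qed.

Hypothesis v_vertex : qi_vertex v.

Let occ4 b : 4 <= occurrences b v.
Proof. by case/andP: v_vertex => _ /forallP /(_ b). Qed.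

Let rank0 (i : 'I_n) : val i = 0 -> rank i = 0.
Proof.
move=> i0; have iA : i \in [set k | v k == v i] by rewrite inE.
rewrite /rank /cls; move: ([set k | _]) iA => A.
case: n i i0 A => [|k] i i0 A iA; first by case: (i).
have ei : i = ord0 by apply: val_inj.
rewrite {}ei {i0} in iA *.
rewrite /enum_mem -enumT enum_ordSl /=.
by rewrite iA.
Qed.

Let companion_vertex (p : pred nat) : p 0 = false ->
  (forall b, 2 <= count (fun k => p k == b) (iota 0 4)) ->
  qi_vertex (companion p).
Proof.
move=> p0 p2; apply/andP; split.
  apply/forallP => i; apply/implyP => /eqP i0; rewrite ffunE rank0 // p0 addbF.
  by case/andP: v_vertex => /forallP /(_ i) /implyP -> //; apply/eqP.
have p2' b c : 2 <= count (fun k => p k == b) (iota 0 (occurrences c v)).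
  by rewrite -(subnKC (occ4 c)) iotaD count_cat (leq_trans (p2 b)) ?leq_addr.
by apply/forallP => b; rewrite occ_companion (leq_add (p2' b _) (p2' (~~ b) _)).
Qed.

Let companion_uniform p : (forall b, occurrences b v = n./2) ->
  forall b, occurrences b (companion p) = n./2.
Proof.
move=> vu b; rewrite occ_companion !vu -[RHS](size_iota 0).
rewrite -(count_predC (fun k => p k == b)); congr (_ + _).
by apply: eq_count => k /=; case: (p k); case: b.
Qed.

Lemma qi_companions : exists v2 v3, [/\ qi_vertex v2, qi_vertex v3,
  qi_independent v v2 v3 &
  (forall b, occurrences b v = n./2) ->
    forall b, occurrences b v2 = n./2 /\ occurrences b v3 = n./2].
Proof.
exists (companion odd), (companion (odd \o half)); split.
- by apply: companion_vertex => // -[].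
- by apply: companion_vertex => // -[].
- apply/forallP => g1; apply/forallP => g2; apply/forallP => g3.
  pose k := (g1 (+) g2) + (g1 (+) g3).*2.
  have k4 : k < size (cls g1).
    rewrite size_cls; apply: leq_trans (occ4 g1); rewrite /k.
    by case: (g1 (+) g2); case: (g1 (+) g3).
  have i0 : 'I_n by case: (cls g1) k4 => // a.
  pose i := nth i0 (cls g1) k.
  have vi : v i = g1.
    by have := mem_nth i0 k4; rewrite -/i /cls mem_enum inE => /eqP.
  have ri : rank i = k by rewrite /rank vi index_uniq // enum_uniq.
  apply/existsP; exists i; rewrite !ffunE vi ri eqxx /= /k.
  by case: g1 {k k4 i vi ri}; case: g2; case: g3.
- by move=> vu b; split; apply: companion_uniform.
Qed.
End Covering.

Lemma QI3_hedges_neq0 n : set0 \notin QI3_hedges n.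
Proof.
apply/negP; rewrite inE => /existsP[x /existsP[y /existsP[z /andP[/eqP E _]]]].
by move/setP: E => /(_ x); rewrite !inE eqxx.
Qed.

Lemma QI3_hedges_cover n : cover (QI3_hedges n) = [set: QI3_vertex n].
Proof.
apply/setP => -[v hv]; rewrite inE; apply/bigcupP.
have [v2 [v3 [h2 h3 ind _]]] := qi_companions hv.
pose x : QI3_vertex n := exist _ v hv; pose y : QI3_vertex n := exist _ v2 h2.
pose z : QI3_vertex n := exist _ v3 h3.
exists [set x; y; z]; last by rewrite !inE eqxx.
rewrite inE; apply/existsP; exists x; apply/existsP; exists y.
by apply/existsP; exists z; rewrite eqxx.
Qed.

Definition QI3 (n : nat) : hypergraph :=
  Hypergraph (QI3_hedges_neq0 n) (QI3_hedges_cover n).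

Definition uniform_vertices (n : nat) : {set QI3 n} :=
  [set v : QI3 n | [forall b : bool, occurrences b (val v) == n./2]].

Lemma uniform_cover n : cover (induced_hedges (uniform_vertices n)) = setT.
Proof.
apply/setP => -[[v hv] uv]; rewrite inE; apply/bigcupP.
have [v2 [v3 [h2 h3 ind un]]] := qi_companions hv.
have vu b : occurrences b v = n./2.
  by move: uv; rewrite inE => /forallP /(_ b) /eqP.
have u2 : (exist _ v2 h2 : QI3 n) \in uniform_vertices n.
  by rewrite inE; apply/forallP => b; rewrite (un vu b).1.
have u3 : (exist _ v3 h3 : QI3 n) \in uniform_vertices n.
  by rewrite inE; apply/forallP => b; rewrite (un vu b).2.
pose x : {x : QI3 n | x \in uniform_vertices n} := exist _ (exist _ v hv) uv.
pose y : {x : QI3 n | x \in uniform_vertices n} := exist _ (exist _ v2 h2) u2.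
pose z : {x : QI3 n | x \in uniform_vertices n} := exist _ (exist _ v3 h3) u3.
exists [set x; y; z]; last by rewrite !inE eqxx.
rewrite inE /= !imsetU !imset_set1 inE; apply/existsP; exists (val x).
apply/existsP; exists (val y); apply/existsP; exists (val z).
by rewrite eqxx.
Qed.

Definition UQI3 (n : nat) : hypergraph :=
  induced_hypergraph (uniform_cover n).

Section MergedJohnson.
Variables (n m : nat) (I : pred nat).

(* Distinctness is automatic when m is not in I; otherwise it excludes      *)
(* loops.                                                                   *)
Definition johnson_adj : rel {M : {set 'I_n} | #|M| == m} :=
  fun M M' => (M != M') && (#|val M :&: val M'| \in I).

Lemma johnson_sym : symmetric johnson_adj.
Proof. by move=> M M'; rewrite /johnson_adj eq_sym setIC. Qed.

Lemma johnson_irrefl : irreflexive johnson_adj.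
Proof. by move=> M; rewrite /johnson_adj eqxx. Qed.

Definition merged_johnson : sgraph := SGraph johnson_sym johnson_irrefl.
End MergedJohnson.

(* Main.v *)
Require Import Defs.
From mathcomp Require Import all_boot zify.

Set Implicit Arguments.
Unset Strict Implicit.
Unset Printing Implicit Defensive.

(** The 2-section [G] of the hypergraph and the merged Johnson graph [J] differ
    only in that [G] keeps one of the two halves of each balanced bipartition
    of the positions, where [J] keeps both. Adjacency does not see this
    difference: in either graph two vertices are adjacent exactly when the
    two bipartitions cut the positions into four cells of at least two
    elements each ([crossing]), a condition invariant under exchanging the
    two halves of a bipartition. For [J] this is a count ([crossing_balanced]):
    if [k] positions lie in both of two sets of size [n/2], then the cells have
    sizes [k], [n/2 - k], [n/2 - k] and [k]. For [G], a third string
    splitting all four cells forces each of them to have two elements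
    ([independent_crossing]), and conversely such a string can be built
    whenever they do ([crossing_independent]).

    Hence taking supports is a homomorphism from [G] to [J], and choosing the
    half that avoids the first position is one from [J] to [G] ([support_hom],
    [choose_half_hom]). Homomorphically equivalent graphs have isomorphic cores
    ([hom_equiv_core_giso]). The composite [J -> G -> J] identifies a set with
    its complement, so [J] is not a core, hence not its own core. Finally [G]
    has at most half as many vertices as [J] ([card_UQI3]); if the core of [J]
    has half the order of [J], the core of [G] is spanning, which forces every
    endomorphism of [G] to be bijective ([large_core_gcore]). A hypergraph
    endomorphism is an endomorphism of the 2-section, and is then bijective
    too. *)

(** * Homomorphisms and cores of graphs *)

Lemma sub_val_hom (G : sgraph) (C : subgraph G) :
  ghom (val : C -> G).
Proof. by move=> x y; case/sub_adjW. Qed.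

Lemma ghom_comp (G K L : sgraph) (f : K -> L) (g : G -> K) :
  ghom f -> ghom g -> ghom (f \o g).
Proof. by move=> hf hg x y /hg /hf. Qed.

(** A bijective endomorphism maps the finite edge set injectively into itself,
    hence onto itself, so it creates no edge. *)
Lemma gautomorphism_adj (G : sgraph) (f : G -> G) :
  gautomorphism f -> forall x y, adj (f x) (f y) = adj x y.
Proof.
move=> [hf /bij_inj fI] x y; apply/idP/idP; last exact: hf.
pose E := [set p : G * G | adj p.1 p.2].
pose F (p : G * G) := (f p.1, f p.2).
have FI : injective F by move=> [a b] [c d] [/fI -> /fI ->].
have /eqP FE : F @: E == E.
  rewrite eqEcard card_imset // leqnn andbT.
  by apply/subsetP => _ /imsetP[p pE ->]; rewrite inE hf //; rewrite inE in pE.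
move=> fxy; have : F (x, y) \in F @: E by rewrite FE inE.
by rewrite mem_imset // inE.
Qed.

(** The homomorphisms of [G] and [K] pass to the cores through inclusions and
    retractions. Both round trips are endomorphisms of cores, so each of the
    two maps is injective, and neither can send a non-edge to an edge. *)
Lemma hom_equiv_core_giso (G K : sgraph) (C : subgraph G) (D : subgraph K) :
  (exists f : G -> K, ghom f) -> (exists g : K -> G, ghom g) ->
  is_core_of C -> is_core_of D -> giso C D.
Proof.
move=> [f hf] [g hg] [coreC [rC hrC]] [coreD [rD hrD]].
pose a : C -> D := rD \o (f \o val); pose b : D -> C := rC \o (g \o val).
have ha : ghom a := ghom_comp hrD (ghom_comp hf (@sub_val_hom _ C)).
have hb : ghom b := ghom_comp hrC (ghom_comp hg (@sub_val_hom _ D)).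
have autC : gautomorphism (b \o a) by apply/coreC/ghom_comp.
have autD : gautomorphism (a \o b) by apply/coreD/ghom_comp.
exists a; split=> [|x y]; last first.
  apply/idP/idP => [/hb axy|]; last exact: ha.
  by rewrite -(gautomorphism_adj autC).
have aI : injective a.
  by move=> x y axy; apply: (bij_inj autC.2); rewrite /= axy.
have bI : injective b.
  by move=> x y bxy; apply: (bij_inj autD.2); rewrite /= bxy.
by apply: inj_card_bij => //; apply: leq_card bI.
Qed.

(** A core of [G] that misses nothing would transport [f] to one of its own
    endomorphisms, which must be bijective. *)
Lemma noninjective_endo_proper_core (G : sgraph) (f : G -> G) :
  ghom f -> ~ injective f ->
  forall D : subgraph G, is_core_of D -> proper_subgraph D.
Proof.
move=> hf fNI D [coreD _] [DT Dadj]; apply: fNI => x y fxy.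
have inD z : z \in sub_vertices D by rewrite DT inE.
pose up z : D := exist _ z (inD z).
have [|_ /bij_inj gI] := coreD (up \o (f \o val)).
  move=> u v uv; rewrite /= /subgraph_adj /= Dadj; apply: hf.
  exact: sub_val_hom uv.
have [] // : up x = up y.
by apply: gI; rewrite /= fxy.
Qed.

(** An endomorphism [h] of [G] becomes one of [C] by composing with the
    inclusion and with [G -> C]; so [h] is injective on [C], and the size of
    [C] makes its image all of [G]. *)
Lemma large_core_gcore (G : sgraph) (C : subgraph G) :
  is_core_of C -> #|G| <= #|vertex C| -> is_gcore G.
Proof.
move=> [coreC [r hr]] leGC h hh; split=> //.
have [_ /bij_inj rhI] := coreC (r \o (h \o val))
  (ghom_comp hr (ghom_comp hh (@sub_val_hom _ C))).
have hvI : injective (h \o val : C -> G).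
  by move=> x y xy; apply: rhI; congr (r _).
have [k _ hK] := inj_card_bij hvI leGC.
exact: injF_bij (can_inj (canF_sym (hK : cancel (val \o k) h))).
Qed.

(** * Balanced strings and their cells *)

Section Strings.
Variable n : nat.
Implicit Types s t w : {ffun 'I_n -> bool}.

Definition balanced s := forall b, occurrences b s = n./2.

Definition flip s (c : bool) : {ffun 'I_n -> bool} := [ffun i => s i (+) c].

Definition cell s t (g h : bool) : {set 'I_n} :=
  [set i | (s i == g) && (t i == h)].

Definition crossing s t : bool :=
  [forall g : bool, forall h : bool, 1 < #|cell s t g h|].

Lemma crossingP s t :
  reflect (forall g h, 1 < #|cell s t g h|) (crossing s t).
Proof.
by apply: (iffP forallP) => H g; [apply/forallP | apply/forallP/H].
Qed.

Lemma independentP s t w :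
  reflect (forall f g h, exists j, [/\ s j = f, t j = g & w j = h])
          (qi_independent s t w).
Proof.
apply: (iffP forallP) => H f.
  move=> g h; move/(_ f)/forallP/(_ g)/forallP/(_ h)/existsP: H => [j].
  by case/and3P => /eqP ? /eqP ? /eqP ?; exists j.
apply/forallP => g; apply/forallP => h; apply/existsP.
by have [j [sj tj wj]] := H f g h; exists j; rewrite sj tj wj !eqxx.
Qed.

Lemma flip_balanced s c : balanced s -> balanced (flip s c).
Proof.
move=> bs b; rewrite -(bs (b (+) c)); apply: eq_card => i.
by rewrite !inE ffunE; case: (s i); case: b; case: c.
Qed.

Lemma crossing_sym s t : crossing s t -> crossing t s.
Proof.
move/crossingP => H; apply/crossingP => g h; rewrite (leq_trans (H h g)) //.
by apply/subset_leq_card/subsetP => i; rewrite !inE andbC.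
Qed.

Lemma crossing_flip s t c d : crossing (flip s c) (flip t d) = crossing s t.
Proof.
have cellE g h : cell (flip s c) (flip t d) g h = cell s t (g (+) c) (h (+) d).
  apply/setP => i; rewrite !inE !ffunE.
  by case: (s i) (t i) g h c d => [] [] [] [] [] [].
apply/crossingP/crossingP => H g h; last by rewrite cellE.
by have := H (g (+) c) (h (+) d); rewrite cellE !addbK.
Qed.

Lemma independent_flip s t w c :
  qi_independent s t w -> qi_independent s t (flip w c).
Proof.
move/independentP => H; apply/independentP => f g h.
have [j [sj tj wj]] := H f g (h (+) c).
by exists j; split; rewrite // ffunE wj addbK.
Qed.

Lemma independent_rot s t w : qi_independent s t w -> qi_independent t w s.
Proof.
move/independentP => H; apply/independentP => f g h.
by have [j [? ? ?]] := H h f g; exists j.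
Qed.

(** Both values of [w] occur in every cell of [s] and [t]. *)
Lemma independent_crossing s t w : qi_independent s t w -> crossing s t.
Proof.
move/independentP => H; apply/crossingP => g h; apply/card_gt1P.
have [i [si ti wi]] := H g h false; have [j [sj tj wj]] := H g h true.
exists i, j; rewrite !inE si ti sj tj !eqxx; split=> //.
by apply/eqP => ij; move: wi; rewrite ij wj.
Qed.

Lemma occurrences_cells s t g :
  occurrences g s = #|cell s t g true| + #|cell s t g false|.
Proof.
rewrite -cardsUI [X in _ + X](_ : _ = 0) ?addn0.
  by apply: eq_card => i; rewrite !inE; case: (t i); case: (s i == g).
by apply: eq_card0 => i; rewrite !inE; case: (t i); rewrite ?andbF.
Qed.

Lemma cellC s t g h : #|cell s t g h| = #|cell t s h g|.
Proof. by apply: eq_card => i; rewrite !inE andbC. Qed.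

Lemma crossing_balanced s t : balanced s -> balanced t ->
  crossing s t = (2 <= #|cell s t true true| <= n./2 - 2).
Proof.
move=> bs bt.
have := occurrences_cells s t true; have := occurrences_cells s t false.
have := occurrences_cells t s true; have := occurrences_cells t s false.
rewrite !bs !bt !(cellC t s) => e1 e2 e3 e4.
apply/crossingP/idP => [H|]; last by move=> H [] []; lia.
have := H true true; have := H true false; lia.
Qed.

(** Complementing [s] and then flipping one position [a g h] in every cell
    gives the third string: each cell holds a flipped and a non-flipped
    position, and balance is kept since two of the flipped positions carry a
    [true] of [s] and two carry a [false]. *)
Lemma crossing_independent s t : balanced s -> crossing s t ->
  exists2 w, balanced w & qi_independent s t w.
Proof.
move=> bs /crossingP st.
have /fin_all_exists[a aP] (gh : bool * bool) :
    exists i, (s i, t i) == gh /\ exists2 j, (s j, t j) == gh & i != j.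
  case: gh => g h; have /card_gt1P[i [j []]] := st g h.
  by rewrite !inE -!xpair_eqE => iP jP ij; exists i; split=> //; exists j.
pose p i := i == a (s i, t i).
pose w := [ffun i => ~~ s i (+) p i].
have sa gh : s (a gh) = gh.1 by case: (aP gh) => /eqP /(congr1 fst).
have ta gh : t (a gh) = gh.2 by case: (aP gh) => /eqP /(congr1 snd).
have pa gh : p (a gh) by rewrite /p sa ta; case: gh.
exists w.
  have card2 b : #|[set i | (s i == b) && p i]| = 2.
    have <- : #|[set a (b, true); a (b, false)]| = 2.
      rewrite cards2; case: eqP => // /(congr1 t).
      by rewrite !ta.
    apply: eq_card => i; rewrite !inE; apply/andP/orP.
      by rewrite /p => -[/eqP <-]; case: (t i); [left | right].
    by case=> /eqP ->; rewrite sa pa.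
  move=> b; have split_p c :
      occurrences c s = 2 + #|[set i | (s i == c) && ~~ p i]|.
    rewrite -(card2 c) -cardsUI [X in _ + X](_ : _ = 0) ?addn0.
      by apply: eq_card => i; rewrite !inE; case: (p i); case: (s i == c).
    by apply: eq_card0 => i; rewrite !inE; case: (p i); rewrite ?andbF.
  rewrite -(bs (~~ b)) split_p -(card2 b) -cardsUI.
  rewrite [X in _ + X](_ : _ = 0) ?addn0.
    apply: eq_card => i; rewrite !inE ffunE.
    by case: (s i); case: (p i); case: b.
  by apply: eq_card0 => i; rewrite !inE; case: (p i); rewrite ?andbF.
apply/independentP => f g h.
have [_ [j /eqP[sj tj] ij]] := aP (f, g).
have pj : p j = false by apply/negbTE; rewrite /p sj tj eq_sym.
(* At a flipped position [w] agrees with [s], at the others it does not. *)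
have [<-|fh] := eqVneq f h.
  by exists (a (f, g)); rewrite ffunE pa sa ta; split=> //=; case: (f).
by exists j; rewrite ffunE pj sj tj; split=> //; case: (f) (h) fh => [] [].
Qed.

End Strings.

(** * The two graphs in terms of balanced strings *)

Definition string (n : nat) (v : UQI3 n) : {ffun 'I_n -> bool} :=
  val (val v).

Lemma string_inj n : injective (@string n).
Proof. by move=> u v /val_inj /val_inj. Qed.

Lemma string_balanced n (v : UQI3 n) : balanced (string v).
Proof.
by move=> b; have := valP v; rewrite inE => /forallP /(_ b) /eqP.
Qed.

Lemma string_first n (v : UQI3 n) (i : 'I_n) : val i = 0 -> string v i = false.
Proof.
move=> i0; case: v => -[v vP] vU; case/andP: (vP) => /forallP /(_ i).
by rewrite i0 => /implyP /(_ (eqxx _)) /eqP.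
Qed.

Section Graphs.
Variables (n : nat) (hn : 8 <= n).

Lemma balanced_vertex (s : {ffun 'I_n -> bool}) : balanced s ->
  exists v : UQI3 n, exists c, string v = flip s c.
Proof.
move=> bs; have n0 : 0 < n by lia.
pose c := s (Ordinal n0); have bf := flip_balanced c bs.
have vP : qi_vertex (flip s c).
  apply/andP; split; last by apply/forallP => b; rewrite bf; lia.
  apply/forallP => i; apply/implyP => /eqP i0; have -> : i = Ordinal n0 by apply: val_inj.
  by rewrite ffunE addbb.
pose v : QI3 n := exist _ (flip s c) vP.
have vU : v \in uniform_vertices n.
  by rewrite inE; apply/forallP => b; rewrite bf.
by exists (exist _ v vU), c.
Qed.

Lemma two_section_crossing (x y : UQI3 n) :
  two_section_adj x y = crossing (string x) (string y).
Proof.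
apply/andP/idP => [[xy /existsP[e /and3P[]]] | cr].
  rewrite inE inE => /existsP[v1 /existsP[v2 /existsP[v3]]].
  case/andP => /eqP eE ind xe ye.
  have := imset_f val xe; have := imset_f val ye; rewrite eE !inE.
  have ind2 := independent_rot ind; have ind3 := independent_rot ind2.
  have := (independent_crossing ind, independent_crossing ind2,
    independent_crossing ind3) => -[[c12 c23] c31].
  rewrite -(inj_eq val_inj) in xy.
  rewrite -!orbA => /or3P[] /eqP yE /or3P[] /eqP xE;
    move: xy; rewrite /string xE yE ?eqxx // => _;
    by [|apply: crossing_sym].
have [w bw ind] := crossing_independent (string_balanced x) cr.
have [z [c zE]] := balanced_vertex bw.
split.
  apply/eqP => xy; move/crossingP/(_ true false)/card_gt1P: cr => [i [j [+ _ _]]].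
  by rewrite xy inE; case: (string y i).
apply/existsP; exists [set x; y; z]; rewrite !inE !eqxx ?orbT andbT.
apply/existsP; exists (val x); apply/existsP; exists (val y).
apply/existsP; exists (val z); rewrite !imsetU !imset_set1 eqxx /=.
by rewrite -[val (val z)]/(string z) zE independent_flip.
Qed.

Hypothesis n_even : ~~ odd n.
Let G := two_section (UQI3 n).
Let J := merged_johnson n n./2 [pred k | 2 <= k <= n./2 - 2].

Definition indicator (M : {set 'I_n}) : {ffun 'I_n -> bool} :=
  [ffun i => i \in M].

Lemma indicator_balanced (M : J) : balanced (indicator (val M)).
Proof.
case: M => M /= /eqP cM b.
have := cardsC M; rewrite cM card_ord => cMC.
have -> : occurrences b (indicator M) = if b then #|M| else #|~: M|.
  by case: b; apply: eq_card => i; rewrite !inE ffunE; case: (i \in M).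
by case: b => //; lia.
Qed.

Lemma support_card s : balanced s -> #|[set i : 'I_n | s i]| == n./2.
Proof.
move=> /(_ true) <-; apply/eqP/eq_card => i.
by rewrite !inE; case: (s i).
Qed.

Lemma johnson_crossing (M N : J) :
  adj M N = crossing (indicator (val M)) (indicator (val N)).
Proof.
rewrite crossing_balanced; do ?exact: indicator_balanced.
have -> : cell (indicator (val M)) (indicator (val N)) true true =
    val M :&: val N.
  by apply/setP => i; rewrite !inE !ffunE !eqb_id.
rewrite /= /johnson_adj inE; case: eqP => // ->.
(* For [M = N] the intersection has [n/2] elements, more than allowed. *)
by rewrite setIid (eqP (valP N)); lia.
Qed.

Definition support (v : G) : J :=
  exist _ [set i | string v i] (support_card (string_balanced v)).

Lemma indicator_support v : indicator (val (support v)) = string v.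
Proof. by apply/ffunP => i; rewrite ffunE inE. Qed.

Lemma support_hom : ghom support.
Proof.
move=> x y; rewrite johnson_crossing !indicator_support.
by rewrite -two_section_crossing.
Qed.

Lemma choose_half_hom : exists2 f : J -> G, ghom f &
  forall M, exists c, string (f M) = flip (indicator (val M)) c.
Proof.
have /fin_all_exists[f fP] (M : J) := balanced_vertex (indicator_balanced M).
exists f => // M N; rewrite johnson_crossing /= two_section_crossing.
by have [c ->] := fP M; have [d ->] := fP N; rewrite crossing_flip.
Qed.

(** A set and its complement have the same image under any such choice, since
    of two complementary strings only one vanishes on the first position. *)
Lemma johnson_noninjective_endo : exists2 f : J -> J, ghom f & ~ injective f.
Proof.
have [f hf fP] := choose_half_hom.
exists (support \o f); first exact: ghom_comp support_hom hf.
move=> sfI; have n0 : 0 < n by lia.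
pose i0 := Ordinal n0.
have normal M : string (f M) = flip (indicator (val M)) (i0 \in val M).
  have [c fM] := fP M; rewrite fM; congr flip.
  have := @string_first _ (f M) i0 erefl; rewrite fM !ffunE.
  by case: c {fM}; case: (i0 \in _).
have [A cA] : exists A : {set 'I_n}, #|A| == n./2.
  have : 0 < #|[set A : {set 'I_n} | #|A| == n./2]|.
    by rewrite card_draws card_ord bin_gt0; lia.
  by case/card_gt0P => A; rewrite inE; exists A.
have cAC : #|~: A| == n./2.
  by have := cardsC A; rewrite card_ord (eqP cA) => cAC; lia.
pose M : J := exist _ A cA; pose N : J := exist _ (~: A) cAC.
have /(congr1 val)/setP/(_ i0) /= : M = N.
  apply: sfI; congr support; apply: string_inj; rewrite !normal.
  by apply/ffunP => i; rewrite !ffunE !inE addNb addbN negbK.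
by rewrite inE; case: (i0 \in A).
Qed.

(** The strings of the vertices and their complements are distinct indicators
    of sets of size [n/2]. *)
Lemma card_UQI3 : #|UQI3 n|.*2 <= 'C(n, n./2).
Proof.
have n0 : 0 < n by lia.
have bal (p : UQI3 n * bool) := flip_balanced p.2 (string_balanced p.1).
pose f p : J := exist _ [set i | _ i] (support_card (bal p)).
have fI : injective f.
  move=> [u b] [v c] /(congr1 val)/setP /= uv.
  have E i : string u i (+) b = string v i (+) c.
    by have := uv i; rewrite !inE !ffunE.
  have bc : b = c.
    by have := E (Ordinal n0); rewrite !string_first.
  rewrite bc; congr pair; apply: string_inj; apply/ffunP => i.
  by have := E i; rewrite bc => /addIb.
have := leq_card f fI; rewrite card_prod card_bool muln2.
move/leq_trans; apply; rewrite card_sig -[X in 'C(X, _)](card_ord n) -card_draws.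
by rewrite eq_leq //; apply: eq_card => M; rewrite !inE.
Qed.

End Graphs.

(** * Hypergraphs and their 2-sections *)

(** A hypergraph homomorphism is injective on every hyperedge, so it keeps
    adjacent vertices of the 2-section distinct. *)
Lemma hhom_two_section (H K : hypergraph) (f : H -> K) :
  hhom f -> @ghom (two_section H) (two_section K) f.
Proof.
move=> hf x y /andP[xy /existsP[e /and3P[eH xe ye]]].
have [e' [e'K /subsetP fe /eqP/imset_injP fI]] := hf e eH.
apply/andP; split; first by apply: contraNneq xy => /fI ->.
by apply/existsP; exists e'; rewrite e'K !fe ?imset_f.
Qed.

Lemma two_section_gcore (H : hypergraph) :
  is_gcore (two_section H) -> is_hcore H.
Proof.
by move=> core f hf; have [_ fB] := core f (hhom_two_section hf).
Qed.

Theorem proposition6 (n : nat) (hn : 8 <= n) (n_even : ~~ odd n) :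
  let J := merged_johnson n n./2 [pred k | 2 <= k <= n./2 - 2] in
  [/\ forall (C : subgraph (two_section (UQI3 n))) (D : subgraph J),
        is_core_of C -> is_core_of D -> giso C D,
      forall D : subgraph J, is_core_of D -> proper_subgraph D
    & forall D : subgraph J, is_core_of D ->
        #|vertex D|.*2 = 'C(n, n./2) -> is_hcore (UQI3 n)].
Proof.
move=> J.
have iso (C : subgraph (two_section (UQI3 n))) (D : subgraph J) :
    is_core_of C -> is_core_of D -> giso C D.
  apply: hom_equiv_core_giso; first by exists (@support n); exact: support_hom.
  by have [f hf _] := choose_half_hom hn n_even; exists f.
split=> // [|D coreD cardD].
  have [f hf fNI] := johnson_noninjective_endo hn n_even.
  exact: noninjective_endo_proper_core hf fNI.
have [C coreC] := core_exists (two_section (UQI3 n)).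
have [f [fB _]] := iso C D coreC coreD.
apply/two_section_gcore/(large_core_gcore coreC).
by rewrite (bij_eq_card fB) -leq_double cardD card_UQI3.
Qed.
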